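(* Let $N\ge1$ and let $p,\ell$ be distinct primes dividing $N$. Then for every $f\in\mathcal{M}(N)$, $f|\mathcal{T}(p)\mathcal{T}(\ell)=f|\mathcal{T}(\ell)\mathcal{T}(p)$.
   Context: Let $q=e^{2\pi i\tau}$. $\mathcal{M}(N)$ denotes the multiplicative group of meromorphic modular forms $f$ on the upper half-plane of some integer weight $k$ for $\Gamma_0(N)$ with some unitary multiplier system (i.e. $f(\gamma\tau)=\chi(\gamma)(c\tau+d)^kf(\tau)$ for $\gamma\in\Gamma_0(N)$, $\chi:\Gamma_0(N)\to S^1$, meromorphic at cusps), with integer Fourier coefficients at $i\infty$ and leading coefficient $1$. With $(f|_k\gamma)(\tau)=\det(\gamma)^{k/2}(c\tau+d)^{-k}f(\gamma\tau)$, for a prime $p\mid N$ and $f\in\mathcal{M}(N)$ of weight $k$: $f|\mathcal{T}(p):=\varepsilon\, p^{\frac{kp}{2}}\prod_{j=0}^{p-1}f|_{k}\begin{psmallmatrix}1&j\\0&p\end{psmallmatrix}$, with $\varepsilon$ the constant making the leading coefficient 1; it lies in $\mathcal{M}(N)$ with weight $kp$. $f|\mathcal{T}(a)\mathcal{T}(b)$ means $(f|\mathcal{T}(a))|\mathcal{T}(b)$, each operator using the weight of its argument. *)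

(* Defs.v *)
From mathcomp Require Import all_boot all_order all_algebra.
From mathcomp Require Import all_classical all_reals all_analysis.
From mathcomp Require Import complex.

Set Implicit Arguments.
Unset Strict Implicit.
Unset Printing Implicit Defensive.

Import Order.TTheory GRing.Theory Num.Theory.
Import numFieldNormedType.Exports.

Local Open Scope classical_set_scope.
Local Open Scope ring_scope.

(* These notions are stated over a [numFieldType] only because the topology of
   [R[i]] is inferred through that structure; they are used with K := R[i]. *)
Section Meromorphy.
Variable K : numFieldType.

Definition has_sum (u : nat -> K) (s : K) : Prop := series u @ \oo --> s.

Definition holomorphic_near (g : K -> K) (z0 : K) : Prop :=
  \forall z \near z0, derivable g z 1.

Definition meromorphic_at (f : K -> K) (z0 : K) : Prop :=
  exists (n : nat) (g : K -> K), holomorphic_near g z0 /\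
    (\forall z \near z0^', f z = g z / (z - z0) ^+ n).

(* A meromorphic function is represented by its normal form: the total function
   taking the value of the removable extension wherever that exists, and 0 at
   the poles.  Each meromorphic function has exactly one such representative. *)
Definition normal_form (f : K -> K) (z0 : K) : K :=
  xget 0 [set v : K | f z @[z --> z0^'] --> v].

End Meromorphy.

Section ModularForms.
Variable R : realType.

Local Notation C := R[i].
Local Notation "x %:C" := (real_complex R x) : ring_scope.

Definition cexp (z : C) : C :=
  (expR (complex.Re z))%:C * Complex (cos (complex.Im z)) (sin (complex.Im z)).

(* q^s = e^{2 pi i s tau} for real s, with no choice of a branch in q *)
Definition qpow (s : R) (tau : C) : C := cexp (Complex 0 (2 * pi * s) * tau).

Definition upper_half_plane : set C := [set tau | 0 < complex.Im tau].

Definition meromorphic_on_H (f : C -> C) : Prop :=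
  forall tau, upper_half_plane tau ->
    meromorphic_at f tau /\ f tau = normal_form f tau.

(* F = q^h * sum_(n >= 0) a_n q^(n/w) for tau of large imaginary part; a nonzero
   multiplier at the cusp makes h an arbitrary real, and a finite principal part
   is absorbed in h. *)
Definition fourier_expansion (w : nat) (h : R) (a : nat -> C) (F : C -> C)
    : Prop :=
  exists Y : R, forall tau, Y < complex.Im tau ->
    has_sum (fun n => a n * qpow (h + n%:R / w%:R) tau) (F tau).

Definition is_leading_coef (F : C -> C) (c : C) : Prop :=
  exists (w : nat) (h : R) (a : nat -> C),
    [/\ (0 < w)%N, fourier_expansion w h a F, a 0%N = c & c != 0].

Definition leading_coef (F : C -> C) : C := xget 0 [set c | is_leading_coef F c].

Definition mat2 (a b c d : int) : 'M[int]_2 :=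
  \matrix_(i < 2, j < 2)
    if i == 0 then (if j == 0 then a else b) else (if j == 0 then c else d).

Definition SL2Z : set 'M[int]_2 := [set g | \det g = 1].

Definition Gamma0 (N : nat) : set 'M[int]_2 :=
  [set g | SL2Z g /\ (N%:Z %| g 1%R 0%R)%Z].

Definition automorphy (g : 'M[int]_2) (tau : C) : C :=
  (g 1 0)%:~R * tau + (g 1 1)%:~R.

Definition moebius (g : 'M[int]_2) (tau : C) : C :=
  ((g 0 0)%:~R * tau + (g 0 1)%:~R) / automorphy g tau.

Definition slash (k : int) (f : C -> C) (g : 'M[int]_2) (tau : C) : C :=
  ((\det g)%:~R `^ (k%:~R / 2))%:C * automorphy g tau ^ (- k)
    * f (moebius g tau).

Definition modular_for (N : nat) (k : int) (f : C -> C) : Prop :=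
  exists chi : 'M[int]_2 -> C,
    (forall g, Gamma0 N g -> `|chi g| = 1) /\
    (forall g tau, Gamma0 N g -> upper_half_plane tau ->
      f (moebius g tau) = chi g * automorphy g tau ^ k * f tau).

Definition meromorphic_at_cusps (k : int) (f : C -> C) : Prop :=
  forall g, SL2Z g -> exists (w : nat) (h : R) (a : nat -> C),
    (0 < w)%N /\ fourier_expansion w h a (slash k f g).

(* f is an element of M(N) of weight k *)
Definition in_M (N : nat) (k : int) (f : C -> C) : Prop :=
  [/\ meromorphic_on_H f,
      modular_for N k f,
      meromorphic_at_cusps k f &
      exists (h : R) (a : nat -> int),
        a 0%N = 1 /\ fourier_expansion 1 h (fun n => (a n)%:~R) f].

(* p^(kp/2) * prod_(j < p) f|_k [1 j; 0 p], as a product of meromorphic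
   functions *)
Definition hecke_product (p : nat) (k : int) (f : C -> C) : C -> C :=
  normal_form (fun tau =>
    (p%:R `^ ((k * p%:Z)%:~R / 2))%:C
      * \prod_(j < p) slash k f (mat2 1 j%:Z 0 p%:Z) tau).

(* f | T(p) for f of weight k *)
Definition hecke (p : nat) (k : int) (f : C -> C) (tau : C) : C :=
  (leading_coef (hecke_product p k f))^-1 * hecke_product p k f tau.

End ModularForms.

(* Main.v *)
(** Up to a nonzero constant and the passage to normal forms, [f | T(n)] is the
   product of the [f ((tau + m) / n)] for [m < n].  Since the residues modulo [pl]
   are the numbers [i + l j] with [i < l] and [j < p], both sides are nonzero
   multiples of the product of the [f ((tau + m) / (pl))] for [m < pl].  The
   leading coefficient of a function with a Fourier expansion is unique, because
   it is the limit of [F q^-h] as [Im tau] tends to infinity; dividing by it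
   therefore cancels these multiples.  The multiples are nonzero because a product
   of translates of [f] is again given by a Fourier expansion for large [Im tau],
   whose leading coefficient is a product of nonzero numbers. *)

Require Import Defs.
From mathcomp Require Import all_boot all_order all_algebra.
From mathcomp Require Import all_classical all_reals all_analysis.
From mathcomp Require Import complex.
From mathcomp Require Import ring.

Set Implicit Arguments.
Unset Strict Implicit.
Unset Printing Implicit Defensive.

Import Order.TTheory GRing.Theory Num.Theory.
Import numFieldNormedType.Exports.

Local Open Scope classical_set_scope.
Local Open Scope ring_scope.

(** * Normal forms and continuity off a point *)

Section NormalForm.
Variable K : numFieldType.
Implicit Types (f g : K -> K) (z : K).

Lemma continuous_prod (n : nat) (F : 'I_n -> K -> K) z :
  (forall i, {for z, continuous (F i)}) ->
  {for z, continuous (fun y => \prod_(i < n) F i y)}.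
Proof.
move=> cF; apply: (@cvg_big K 'I_n *%R 1 predT mul_continuous K (nbhs z)).
by move=> i _; exact: cF.
Qed.

(** This consequence of meromorphy passes to products and affine substitutions, and makes
    [normal_form f] agree with [f] around [z0], the point itself excepted. *)
Definition continuous_near_punctured f z0 : Prop :=
  \forall z \near z0^', {for z, continuous f}.

(** A point of the punctured neighbourhood differs from [z0], so a whole neighbourhood of it still
    avoids [z0]. *)
Lemma near_punctured_near (P : K -> Prop) (z0 : K) :
  (\forall z \near z0^', P z) -> \forall z \near z0^', \forall y \near z, P y.
Proof.
rewrite /dnbhs /within /= => /near_join; apply: filterS => z Pz /eqP zz0.
have : \forall y \near z, y != z0.
  have h : \forall y \near z, y - z0 != 0.
    apply: (@cvgr_neq0 K K K (nbhs z) _ (fun y => y - z0) (z - z0)).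
      by apply: cvgB; [exact: cvg_id | exact: cvg_cst].
    by rewrite subr_eq0; exact/eqP.
  by apply: filterS h => y; rewrite subr_eq0.
by move=> yz0; near=> y; near: y; apply: filterS2 Pz yz0 => y Py yz0; exact: Py.
Unshelve. all: by end_near. Qed.

(** Around each nearby [z] other than [z0] the quotient formula holds on a full neighbourhood, where
    [g] is continuous and the denominator does not vanish at [z]. *)
Lemma meromorphic_at_continuous f z0 :
  meromorphic_at f z0 -> continuous_near_punctured f z0.
Proof.
move=> [n [g [hg fE]]]; have /near_punctured_near fE' := fE.
have hg' : \forall z \near z0^', derivable g z 1 by exact: nbhs_dnbhs.
have neq : \forall z \near z0^', z != z0 by exact: nbhs_dnbhs_neq.
rewrite /continuous_near_punctured; near=> z.
have nz : z != z0 by near: z.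
have fz : \forall y \near z, f y = g y / (y - z0) ^+ n by near: z.
have gz : {for z, continuous g}.
  by apply: differentiable_continuous; apply/derivable1_diffP; near: z.
have cz : {for z, continuous (fun y => g y / (y - z0) ^+ n)}.
  apply: continuousM => //; apply: continuousV.
    by rewrite expf_neq0 // subr_eq0.
  have -> : (fun y => (y - z0) ^+ n) = (fun y => \prod_(i < n) (y - z0)).
    by apply/funext => y; rewrite prodr_const card_ord.
  apply: continuous_prod => i.
  by apply: continuousB; [exact: cvg_id | exact: cst_continuous].
rewrite /prop_for /continuous_at (nbhs_singleton fz).
apply: cvg_trans cz; apply: (@near_eq_cvg _ _ (nbhs z)).
by apply: (@filterS _ (nbhs z)) fz => y ->.
Unshelve. all: by end_near. Qed.

(** The limit along [z0^'] sees only values off [z0], so both sides choose from the same set of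
    limits. *)
Lemma normal_form_near f g z0 :
  (\forall z \near z0^', f z = g z) -> normal_form f z0 = normal_form g z0.
Proof.
move=> fg; rewrite /normal_form; congr xget; apply/seteqP; split=> v /= h.
  by apply: cvg_trans h; exact: near_eq_cvg.
by apply: cvg_trans h; apply: near_eq_cvg; apply: filterS fg => z ->.
Qed.

Lemma normal_form_limit f z0 v : f z @[z --> z0^'] --> v -> normal_form f z0 = v.
Proof.
move=> fv; apply: xget_unique => // w fw.
exact: (cvg_unique (@norm_hausdorff K K) fw fv).
Qed.

Lemma normal_form_continuous f z0 :
  {for z0, continuous f} -> normal_form f z0 = f z0.
Proof. by move=> /continuous_withinNx; exact: normal_form_limit. Qed.

Lemma near_punctured_normal_form f z0 : continuous_near_punctured f z0 ->
  \forall z \near z0^', normal_form f z = f z.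
Proof. by apply: (@filterS _ (nbhs z0^')) => z; exact: normal_form_continuous. Qed.

(* The set of limits scales with [c], so this also holds when there is no limit
   and both sides are the default value 0. *)
Lemma normal_form_scale (c : K) f z0 : c != 0 ->
  normal_form (fun z => c * f z) z0 = c * normal_form f z0.
Proof.
move=> c0.
have cvg_scale (b : K) g v :
  g z @[z --> z0^'] --> v -> b * g z @[z --> z0^'] --> b * v.
  by move=> h; apply: cvgM => //; exact: cvg_cst.
have [[v fv]|nf] := pselect (exists v : K, f z @[z --> z0^'] --> v).
  by rewrite (normal_form_limit fv) (normal_form_limit (cvg_scale c _ _ fv)).
rewrite {2}/normal_form xgetPN ?mulr0; last by move=> v fv; apply: nf; exists v.
rewrite /normal_form xgetPN // => v /= /(cvg_scale c^-1) fv; apply: nf.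
exists (c^-1 * v); apply: cvg_trans fv; apply: (@near_eq_cvg _ _ (z0^')).
by apply: nearW => z; rewrite mulKf.
Qed.

Lemma continuous_near_punctured_prod (n : nat) (F : 'I_n -> K -> K) z0 :
  (forall i, continuous_near_punctured (F i) z0) ->
  continuous_near_punctured (fun z => \prod_(i < n) F i z) z0.
Proof.
move=> cF; have : \forall z \near z0^', forall i, {for z, continuous (F i)}.
  exact: filter_forall.
by apply: (@filterS _ (nbhs z0^')) => z h; exact: continuous_prod.
Qed.

(** Injectivity of the affine map keeps points other than [z0] away from the image of [z0]. *)
Lemma shift_scale_punctured (a b z0 : K) : a != 0 ->
  a * (z + b) @[z --> z0^'] --> (a * (z0 + b))^'.
Proof.
move=> a0; apply: (@continuous_injective_withinNx _ _ (fun z => a * (z + b))).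
  apply: continuousM; first exact: cst_continuous.
  by apply: continuousD; [exact: cvg_id | exact: cst_continuous].
by move=> y /(mulfI a0)/addIr.
Qed.

Lemma continuous_near_punctured_affine f (a b z0 : K) : a != 0 ->
  continuous_near_punctured f (a * (z0 + b)) ->
  continuous_near_punctured (fun z => f (a * (z + b))) z0.
Proof.
move=> a0 /(shift_scale_punctured a0); apply: (@filterS _ (nbhs z0^')) => z fz.
apply: (@continuous_comp _ _ _ (fun z => a * (z + b)) f) => //.
apply: continuousM; first exact: cst_continuous.
by apply: continuousD; [exact: cvg_id | exact: cst_continuous].
Qed.

End NormalForm.

(** * Power series *)

Section PowerSeries.
Variable K : numFieldType.
Implicit Types (a b u : nat -> K) (x y s t M r c : K).

(** The order of [K] is partial, but a norm and a nonnegative number are both real, hence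
    comparable; this permits the argument by contradiction. *)
Lemma norm_limit_le u s M : 0 <= M -> (forall n, `|u n| <= M) ->
  u n @[n --> \oo] --> s -> `|s| <= M.
Proof.
move=> M0 uM us; rewrite real_leNgt ?normr_real ?ger0_real //.
apply/negP => Ms; move/cvgrPdist_lt : us => /(_ (`|s| - M)).
rewrite subr_gt0 => /(_ Ms) [n _ /(_ n (leqnn n))] /=.
move=> h; suff : `|s| < `|s| by rewrite ltxx.
rewrite -{1}(subrK (u n) s); apply: le_lt_trans (ler_normD _ _) _.
by rewrite -(subrK M `|s|) ltr_leD.
Qed.

Lemma has_sum_bounded u s : has_sum u s -> exists2 M, 0 <= M & forall n, `|u n| <= M.
Proof.
move=> us; have /cvg_series_cvg_0 u0 : cvgn (series u) by apply/cvg_ex; exists s.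
have /cvg_seq_bounded bu : cvgn u by apply/cvg_ex; exists 0.
have [M /ltW M0 uM] := ex_strict_bound_gt0 bu.
by exists M => // n; apply/ltW/(uM n I).
Qed.

Lemma has_sumZ c u s : has_sum u s -> has_sum (fun n => c * u n) (c * s).
Proof.
move=> us; rewrite /has_sum.
have -> : series (fun n => c * u n) = (fun n => c * series u n).
  by apply/funext => n; rewrite /series /= mulr_sumr.
by apply: cvgM => //; exact: cvg_cst.
Qed.

Lemma has_sum_at0 a : has_sum (fun n => a n * 0 ^+ n) (a 0%N).
Proof.
apply: cvg_near_cst; exists 1%N => // -[//|n] _.
rewrite /series /= big_nat_recl //= expr0 mulr1 big1 ?addr0 //.
by move=> i _; rewrite expr0n mulr0.
Qed.

(** In the induction step each of the two summands is at most [2^-n |x - y|], and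
    [2 * 2^-n = 4 * 2^-(n+1)]. The decay in [n] makes termwise differences of power series
    summable. *)
Lemma power_diff_le x y n : `|x| <= 4^-1 -> `|y| <= 4^-1 ->
  `|x ^+ n - y ^+ n| <= 4 * 2^-1 ^+ n * `|x - y|.
Proof.
move=> hx hy; elim: n => [|n ih]; first by rewrite !expr0 subrr normr0 mulr_ge0.
have -> : x ^+ n.+1 - y ^+ n.+1 = x * (x ^+ n - y ^+ n) + (x - y) * y ^+ n.
  by rewrite !exprS; ring.
apply: le_trans (ler_normD _ _) _; rewrite !normrM.
have -> : 4 * 2^-1 ^+ n.+1 * `|x - y| =
    4^-1 * (4 * 2^-1 ^+ n * `|x - y|) + `|x - y| * 2^-1 ^+ n.
  by rewrite exprS; field.
apply: lerD; first by apply: ler_pM.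
apply: ler_pM => //; rewrite normrX; apply: lerXn2r; rewrite ?nnegrE //.
by apply: le_trans hy _; rewrite lef_pV2 ?posrE // ler_nat.
Qed.

Lemma sum_half_le n : \sum_(i < n) (2^-1 ^+ i : K) <= 2.
Proof.
have -> : \sum_(i < n) (2^-1 ^+ i : K) = 2 - 2 * 2^-1 ^+ n.
  by elim: n => [|n ih]; rewrite ?big_ord0 ?big_ord_recr /= ?ih ?exprS; field.
by rewrite gerBl mulr_ge0 // exprn_ge0.
Qed.

(** [power_diff_le] at [x r] and [y r] bounds each term, and the geometric sum gives [8 = 4 * 2].
    This one estimate yields continuity in [x] and, with [y = 0], convergence to the constant
    term. *)
Lemma power_series_lipschitz a M r x y s t : 0 <= M -> 0 <= r ->
  (forall n, `|a n| <= M * r ^+ n) -> `|x| * r <= 4^-1 -> `|y| * r <= 4^-1 ->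
  has_sum (fun n => a n * x ^+ n) s -> has_sum (fun n => a n * y ^+ n) t ->
  `|s - t| <= 8 * M * r * `|x - y|.
Proof.
move=> M0 r0 aM hx hy hs ht.
apply: (@norm_limit_le
  (fun n => series (fun n => a n * x ^+ n) n - series (fun n => a n * y ^+ n) n)).
- by rewrite !mulr_ge0.
- move=> n; rewrite /series /= -sumrB !big_mkord.
  apply: le_trans (ler_norm_sum _ _ _) _.
  apply: (@le_trans _ _ (\sum_(i < n) (M * (4 * 2^-1 ^+ i * (r * `|x - y|))))).
    apply: ler_sum => i _; rewrite -mulrBr normrM.
    apply: le_trans (ler_wpM2r _ (aM i)) _ => //.
    rewrite -[M * _ * _]mulrA; apply: ler_wpM2l => //.
    have := @power_diff_le (x * r) (y * r) i.
    rewrite -mulrBl !exprMn -mulrBl !normrM (ger0_norm (exprn_ge0 _ r0)) (ger0_norm r0).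
    by rewrite [r * _]mulrC [r ^+ _ * _]mulrC; apply.
  rewrite -mulr_sumr -mulr_suml -mulr_sumr.
  have -> : 8 * M * r * `|x - y| = M * (4 * 2 * (r * `|x - y|)) by ring.
  by rewrite ler_wpM2l // ler_wpM2r ?mulr_ge0 // ler_wpM2l // sum_half_le.
- by apply: cvgB.
Qed.

(** * Products of power series *)

Hypothesis K_archi : forall e : K, 0 < e -> exists n, 2^-1 ^+ n < e.

Lemma geometric_bound_cvg0 u M : (forall n, `|u n| <= M * 2^-1 ^+ n) ->
  u n @[n --> \oo] --> (0 : K).
Proof.
move=> uM; have M0 : 0 <= M by have := uM 0%N; rewrite mulr1; exact: le_trans.
apply/cvgrPdist_lt => e e0.
(* [M + 1] keeps the denominator positive when [M] is 0. *)
have [|N hN] := @K_archi (e / (M + 1)); first by rewrite divr_gt0 // ltr_wpDl.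
exists N => // n /= Nn; rewrite sub0r normrN.
apply: le_lt_trans (uM n) _.
apply: (@le_lt_trans _ _ ((M + 1) * 2^-1 ^+ N)).
  apply: ler_pM => //; rewrite ?exprn_ge0 ?lerDl //.
  by apply: ler_wiXn2l => //; rewrite invf_le1 // ler1n.
by rewrite mulrC -ltr_pdivlMr // ltr_wpDl.
Qed.

Definition cauchy_product a b n : K := \sum_(i < n.+1) a i * b (n - i)%N.

(** Each of the [n + 1] terms is at most [M M' r^n]; absorbing [n + 1 <= 2^n] doubles the growth
    ratio. *)
Lemma cauchy_product_le a b M M' r n : 0 <= M -> 0 <= r ->
  (forall n, `|a n| <= M * r ^+ n) -> (forall n, `|b n| <= M' * r ^+ n) ->
  `|cauchy_product a b n| <= M * M' * (2 * r) ^+ n.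
Proof.
move=> M0 r0 aM bM; apply: le_trans (ler_norm_sum _ _ _) _.
have M'0 : 0 <= M' by have := bM 0%N; rewrite mulr1; exact: le_trans.
apply: (@le_trans _ _ (\sum_(i < n.+1) (M * M' * r ^+ n))).
  apply: ler_sum => i _; rewrite normrM.
  have -> : M * M' * r ^+ n = (M * r ^+ i) * (M' * r ^+ (n - i)).
    by rewrite mulrACA -exprD subnKC // -ltnS.
  exact: ler_pM.
rewrite sumr_const card_ord exprMn mulrCA -[X in X <= _]mulr_natl ler_wpM2r //.
  by rewrite !mulr_ge0 ?exprn_ge0.
by rewrite -natrX ler_nat ltn_expl.
Qed.

(* For r |x| <= 1/8 the terms of index N <= n < 2N by which the product of the
   N-th partial sums exceeds the N-th partial sum of the Cauchy product add up to
   O(N 4^-N); this avoids absolute convergence. *)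
Lemma has_sum_mul a b M M' r x s t : 0 <= M -> 0 <= r ->
  (forall n, `|a n| <= M * r ^+ n) -> (forall n, `|b n| <= M' * r ^+ n) ->
  `|x| * r <= 8^-1 ->
  has_sum (fun n => a n * x ^+ n) s -> has_sum (fun n => b n * x ^+ n) t ->
  has_sum (fun n => cauchy_product a b n * x ^+ n) (s * t).
Proof.
move=> M0 r0 aM bM hx hs ht.
have M'0 : 0 <= M' by have := bM 0%N; rewrite mulr1; exact: le_trans.
rewrite /has_sum.
pose S a n := series (fun n => a n * x ^+ n) n.
pose D n := S a n * S b n - S (cauchy_product a b) n.
have -> : series (fun n => cauchy_product a b n * x ^+ n) =
    (fun n => S a n * S b n - D n).
  by apply/funext => n; rewrite /D opprB addrC subrK.
rewrite -[s * t]subr0; apply: cvgB; first exact: cvgM.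
apply: (@geometric_bound_cvg0 _ (M * M')) => N; rewrite -[X in `|X|]/(D N).
(* Partial sums are values of truncated polynomials. Below degree [N] the coefficients of [A * B]
   are those of the Cauchy product, so [D N] is the part of degree at least [N]. *)
pose A := \poly_(i < N) a i; pose B := \poly_(i < N) b i.
have SE (c : nat -> K) : S c N = (\poly_(i < N) c i).[x].
  by rewrite /S /series /= big_mkord horner_poly.
have ABsize : (size (A * B)%R <= N + N)%N.
  apply: leq_trans (size_polyMleq _ _) _; apply: leq_trans (leq_pred _) _.
  by apply: leq_add; exact: size_poly.
have ABcoef i : `|(A * B)`_i| <= M * M' * (2 * r) ^+ i.
  rewrite coefM; apply: cauchy_product_le => // n; rewrite coef_poly; case: ifP => // _;
  by rewrite normr0 mulr_ge0 // exprn_ge0.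
have -> : D N = \sum_(N <= i < N + N) (A * B)`_i * x ^+ i.
  rewrite /D !SE -hornerM -/A -/B (horner_coef_wide _ ABsize) horner_poly.
  rewrite -!(big_mkord xpredT (fun i => _ i * x ^+ i)) (@big_cat_nat _ _ _ N) ?leq_addr //=.
  rewrite [X in X + _ - _](_ : _ = \sum_(0 <= i < N) cauchy_product a b i * x ^+ i).
    by rewrite addrAC subrr add0r.
  rewrite !big_mkord; apply: eq_bigr => i _; congr (_ * _).
  rewrite coefM; apply: eq_bigr => j _; rewrite !coef_poly.
  rewrite (leq_ltn_trans (leq_ord j) (ltn_ord i)).
  by rewrite (leq_ltn_trans (leq_subr _ _) (ltn_ord i)).
apply: le_trans (ler_norm_sum _ _ _) _.
apply: (@le_trans _ _ (\sum_(N <= i < N + N) (M * M' * 4^-1 ^+ N))).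
  rewrite !big_nat; apply: ler_sum => i /andP[Ni _].
  rewrite normrM normrX.
  apply: (@le_trans _ _ (M * M' * (2 * r) ^+ i * `|x| ^+ i)).
    by rewrite ler_wpM2r // exprn_ge0.
  rewrite -mulrA -exprMn ler_wpM2l ?mulr_ge0 //.
  (* The bound 1/8 on [|x| r] gives [2 r |x| <= 1/4]. *)
  apply: (@le_trans _ _ (4^-1 ^+ i)).
    apply: lerXn2r; rewrite ?nnegrE ?mulr_ge0 //.
    have -> : (4^-1 : K) = 2 * 8^-1 by field.
    by rewrite -mulrA ler_wpM2l // mulrC.
  by apply: ler_wiXn2l => //; rewrite invf_le1 // ler1n.
rewrite sumr_const_nat addnK -[X in X <= _]mulr_natr -[X in X <= _]mulrA.
rewrite ler_wpM2l ?mulr_ge0 //.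
(* One factor [2^-N] absorbs the number [N] of terms; the other remains as the geometric bound. *)
have -> : (4^-1 : K) = 2^-1 * 2^-1 by field.
rewrite exprMn -mulrA ler_piMr ?exprn_ge0 //.
rewrite exprVn ler_pdivrMl ?exprn_gt0 // mulr1 -natrX ler_nat.
exact/ltnW/ltn_expl.
Qed.

End PowerSeries.

(** * Fourier expansions *)

Section ComplexExponential.
Variable R : realType.
Local Notation C := (R[i] : numFieldType).
Local Notation "x %:C" := (real_complex R x) : ring_scope.

(** A positive element of [R[i]] is real, so the Archimedean property of [R] applies. This
    discharges [K_archi]. *)
Lemma complex_archi (e : R[i]) : 0 < e -> exists n, 2^-1 ^+ n < e.
Proof.
case: e => e d; rewrite ltcE /= => /andP[/eqP -> e0].
exists (Num.bound e^-1).
have -> : (2^-1 : R[i]) ^+ Num.bound e^-1 = (2^-1 ^+ Num.bound e^-1)%:C.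
  by rewrite rmorphXn /= fmorphV rmorph_nat.
rewrite ltcR exprVn invf_plt ?posrE ?exprn_gt0 //.
have h : e^-1 < (Num.bound e^-1)%:R by apply: archi_boundP; rewrite invr_ge0 ltW.
by apply: lt_le_trans h _; rewrite -natrX ler_nat ltnW // ltn_expl.
Qed.

Lemma ler_norm_Im (z : R[i]) : `|complex.Im z|%:C <= `|z|.
Proof.
have norm_i : `|'i%C| = 1 :> R[i].
  by rewrite normc_def /= expr0n expr1n add0r sqrtr1.
by rewrite -normrN -ReiNIm (le_trans (normc_ge_Re _)) // normrM norm_i mulr1.
Qed.

Lemma continuous_Re (z : C) : {for z, continuous (@complex.Re R : C -> R)}.
Proof.
apply/(@cvgrPdist_lt R R C (nbhs z) _) => e e0.
have : \forall w \near z, `|z - w| < e%:C.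
  apply: (@cvgr_dist_lt C C C (nbhs z) _ id z); [exact: cvg_id | by rewrite ltcR].
apply: (@filterS _ (nbhs z)) => w zw.
by rewrite -ltcR -raddfB; apply: le_lt_trans zw; exact: normc_ge_Re.
Qed.

Lemma continuous_Im (z : C) : {for z, continuous (@complex.Im R : C -> R)}.
Proof.
apply/(@cvgrPdist_lt R R C (nbhs z) _) => e e0.
have : \forall w \near z, `|z - w| < e%:C.
  apply: (@cvgr_dist_lt C C C (nbhs z) _ id z); [exact: cvg_id | by rewrite ltcR].
apply: (@filterS _ (nbhs z)) => w zw.
by rewrite -ltcR -raddfB; apply: le_lt_trans zw; exact: ler_norm_Im.
Qed.

Lemma norm_real_complex (x : R) : `|x%:C| = `|x|%:C.
Proof. by rewrite normc_def /= expr0n addr0 sqrtr_sqr. Qed.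

Lemma continuous_real_complex (x : R) : {for x, continuous (real_complex R : R -> C)}.
Proof.
apply/(@cvgrPdist_lt C C R (nbhs x) _) => -[e d].
rewrite ltcE /= => /andP[/eqP -> e0].
have : \forall w \near x, `|x - w| < e.
  by apply: (@cvgr_dist_lt R R R (nbhs x) _ id x); [exact: cvg_id | ].
apply: (@filterS _ (nbhs x)) => w xw.
by rewrite -rmorphB norm_real_complex ltcR.
Qed.

Lemma near_Im_gt (Y : R) (z : C) :
  Y < complex.Im z -> \forall w \near z, Y < complex.Im w.
Proof.
by move=> h; apply: (@cvgr_gt R C (nbhs z) _ (@complex.Im R) _ (continuous_Im (z := z))).
Qed.

Lemma cexpD (z w : R[i]) : cexp (z + w) = cexp z * cexp w.
Proof.
case: z w => a b [c d]; rewrite /cexp /= expRD cosD sinD.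
by apply/eqP; rewrite eq_complex /=; apply/andP; split; apply/eqP; ring.
Qed.

Lemma norm_cexp (z : R[i]) : `|cexp z| = (expR (complex.Re z))%:C.
Proof.
rewrite /cexp normrM norm_real_complex (ger0_norm (expR_ge0 _)) normc_def /=.
by rewrite cos2Dsin2 sqrtr1 mulr1.
Qed.

Lemma cexp_neq0 (z : R[i]) : cexp z != 0.
Proof. by rewrite -normr_eq0 norm_cexp fmorph_eq0 gt_eqF // expR_gt0. Qed.

Lemma cexp0 : cexp (0 : R[i]) = 1.
Proof. by rewrite /cexp /= expR0 cos0 sin0 mul1r. Qed.

Lemma continuous_cexp (z : C) : {for z, continuous (@cexp R : C -> C)}.
Proof.
have cE : {for z, continuous (@expR R \o @complex.Re R : C -> R)}.
  by apply: (@continuous_comp C R R); [exact: continuous_Re | exact: continuous_expR].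
have cC : {for z, continuous (@cos R \o @complex.Im R : C -> R)}.
  by apply: (@continuous_comp C R R); [exact: continuous_Im | exact: continuous_cos].
have cS : {for z, continuous (@sin R \o @complex.Im R : C -> R)}.
  by apply: (@continuous_comp C R R); [exact: continuous_Im | exact: continuous_sin].
pose u : C -> R := (@expR R \o @complex.Re R) \* (@cos R \o @complex.Im R).
pose v : C -> R := (@expR R \o @complex.Re R) \* (@sin R \o @complex.Im R).
have cu : {for z, continuous u} by exact: continuousM.
have cv : {for z, continuous v} by exact: continuousM.
have -> : (@cexp R : C -> C) = (fun w => (u w)%:C + 'i%C * (v w)%:C).
  apply/funext => w; rewrite /cexp; apply/eqP; rewrite eq_complex /=.
  by apply/andP; split; apply/eqP; rewrite /u /v /=; ring.
apply: continuousD.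
  exact: (@continuous_comp C R C _ _ z cu (@continuous_real_complex _)).
apply: continuousM; first exact: cst_continuous.
exact: (@continuous_comp C R C _ _ z cv (@continuous_real_complex _)).
Qed.

(** * Real powers of q *)

Implicit Types (s t : R) (z w : R[i]).

Lemma qpowD s t z : qpow (s + t) z = qpow s z * qpow t z.
Proof.
have E : Complex 0 (2 * pi * (s + t)) =
    Complex 0 (2 * pi * s) + Complex 0 (2 * pi * t) :> R[i].
  by apply/eqP; rewrite eq_complex /= addr0 eqxx mulrDr /=.
by rewrite /qpow E mulrDl cexpD.
Qed.

Lemma qpowDr s z w : qpow s (z + w) = qpow s z * qpow s w.
Proof. by rewrite /qpow mulrDr cexpD. Qed.

Lemma qpow_neq0 s z : qpow s z != 0. Proof. exact: cexp_neq0. Qed.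

Lemma qpow0 z : qpow 0 z = 1.
Proof. by rewrite /qpow mulr0 (mul0r z) cexp0. Qed.

Lemma qpowN s z : qpow (- s) z = (qpow s z)^-1.
Proof.
by apply: (mulIf (qpow_neq0 s z)); rewrite -qpowD addNr qpow0 mulVf // qpow_neq0.
Qed.

Lemma qpow_natl s n z : qpow (n%:R * s) z = qpow s z ^+ n.
Proof.
elim: n => [|n ih]; first by rewrite mul0r qpow0.
by rewrite exprS -ih -qpowD -natr1 mulrDl mul1r addrC.
Qed.

Lemma qpow_scale s t z : qpow s (t%:C * z) = qpow (s * t) z.
Proof.
have E : Complex 0 (2 * pi * s) * t%:C = Complex 0 (2 * pi * (s * t)) :> R[i].
  by apply/eqP; rewrite eq_complex /=; apply/andP; split; apply/eqP; ring.
by rewrite /qpow mulrA E.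
Qed.

Lemma norm_qpow s z : `|qpow s z| = (expR (- (2 * pi * s * complex.Im z)))%:C.
Proof. by rewrite /qpow norm_cexp; case: z => a b /=; rewrite mul0r sub0r. Qed.

Lemma continuous_qpow s z : {for z, continuous (qpow s : C -> C)}.
Proof.
apply: (@continuous_comp C C C (fun w => Complex 0 (2 * pi * s) * w) (@cexp R)).
  by apply: continuousM; [exact: cst_continuous | exact: cvg_id].
exact: continuous_cexp.
Qed.

Lemma qpow_small s (e : R) : 0 < s -> 0 < e ->
  exists Y : R, forall z, Y < complex.Im z -> `|qpow s z| < e%:C.
Proof.
move=> s0 e0; exists (e^-1 / (2 * pi * s)) => z.
have c0 : 0 < 2 * pi * s by rewrite !mulr_gt0 // pi_gt0.
rewrite ltr_pdivrMr // norm_qpow ltcR mulrC => h.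
rewrite expRN invf_plt ?posrE ?expR_gt0 //.
apply: lt_le_trans h _; apply: le_trans (expR_ge1Dx _).
by rewrite lerDr.
Qed.

End ComplexExponential.

(** * Expansions in q^(1/w) and their leading coefficients *)

Section FourierExpansion.
Variable R : realType.
Local Notation C := (R[i] : numFieldType).
Local Notation "x %:C" := (real_complex R x) : ring_scope.
Implicit Types (h : R) (w : nat) (a b : nat -> R[i]) (F G : R[i] -> R[i]) (z : R[i]).

Lemma qpow_term h w n z :
  qpow (h + n%:R / w%:R) z = qpow h z * qpow (w%:R^-1) z ^+ n.
Proof. by rewrite qpowD qpow_natl. Qed.

(** Dividing by [q^h] leaves a power series in [q^(1/w)], to which the estimates above apply; the
    next lemma is the way back. *)
Lemma fourier_power_series h w a F z :
  has_sum (fun n => a n * qpow (h + n%:R / w%:R) z) (F z) ->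
  has_sum (fun n => a n * qpow (w%:R^-1) z ^+ n) (F z * qpow (- h) z).
Proof.
move=> /(@has_sumZ R[i] (qpow (- h) z)); rewrite mulrC.
suff -> : (fun n => qpow (- h) z * (a n * qpow (h + n%:R / w%:R) z)) =
  (fun n => a n * qpow (w%:R^-1) z ^+ n) by [].
apply/funext => n; rewrite qpow_term qpowN mulrCA.
by rewrite mulKf // qpow_neq0.
Qed.

Lemma power_series_fourier h w a s z :
  has_sum (fun n => a n * qpow (w%:R^-1) z ^+ n) s ->
  has_sum (fun n => a n * qpow (h + n%:R / w%:R) z) (qpow h z * s).
Proof.
move=> /(@has_sumZ R[i] (qpow h z)).
suff -> : (fun n => qpow h z * (a n * qpow (w%:R^-1) z ^+ n)) =
  (fun n => a n * qpow (h + n%:R / w%:R) z) by [].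
by apply/funext => n; rewrite qpow_term mulrCA.
Qed.

(** Convergence at a single point, with [x = q^(1/w)] there, bounds all [a_n x^n]; hence
    [r = 1/|x|]. *)
Lemma fourier_coef_growth h w a F : fourier_expansion w h a F ->
  exists M r : R, [/\ 0 <= M, 0 <= r & forall n, `|a n| <= M%:C * r%:C ^+ n].
Proof.
move=> [Y FY]; pose z : R[i] := Complex 0 (Y + 1).
have /FY/fourier_power_series/has_sum_bounded [M M0 aM] : Y < complex.Im z.
  by rewrite /= ltrDl.
have ME : (complex.Re M)%:C = M by apply/RRe_real/ger0_real.
exists (complex.Re M), (expR (- (2 * pi * w%:R^-1 * complex.Im z)))^-1.
rewrite invr_ge0 expR_ge0 -(@lecR R) ME; split=> // n.
have -> : (expR (- (2 * pi * w%:R^-1 * complex.Im z)))^-1%:C = `|qpow w%:R^-1 z|^-1.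
  by rewrite norm_qpow fmorphV.
rewrite exprVn ler_pdivlMr ?exprn_gt0 ?normr_gt0 ?qpow_neq0 //.
by rewrite -normrX -normrM.
Qed.

Lemma qpow_inv_small w (r e : R) : (0 < w)%N -> 0 <= r -> 0 < e ->
  exists Y : R, forall z, Y < complex.Im z -> `|qpow (w%:R^-1) z| * r%:C < e%:C.
Proof.
move=> w0 r0 e0; have [||Y hY] := @qpow_small R w%:R^-1 (e / (r + 1)).
- by rewrite invr_gt0 ltr0n.
- by rewrite divr_gt0 // ltr_wpDl.
exists Y => z /hY qz.
apply: (@le_lt_trans _ _ (`|qpow (w%:R^-1) z| * (r + 1)%:C)).
  by rewrite ler_wpM2l // lecR lerDl.
have r1 : (0 : R[i]) < (r + 1)%:C by rewrite ltcR ltr_wpDl.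
by rewrite -ltr_pdivlMr // -fmorphV -rmorphM.
Qed.

Lemma real_inv_nat n : (n%:R^-1 : R[i]) = (n%:R^-1 : R)%:C.
Proof. by rewrite fmorphV rmorph_nat. Qed.

(** The common growth ratio [r + r'] serves both factors, and [|q^(1/w)| (r + r') <= 1/8] once
    [Im z] is large. *)
Lemma fourier_expansion_mul w h h' a b F G : (0 < w)%N ->
  fourier_expansion w h a F -> fourier_expansion w h' b G ->
  fourier_expansion w (h + h') (cauchy_product a b) (fun z => F z * G z).
Proof.
move=> w0 aF bG.
have [M [r [M0 r0 aM]]] := fourier_coef_growth aF.
have [M' [r' [M'0 r'0 bM]]] := fourier_coef_growth bG.
have [Y1 FY] := aF; have [Y2 GY] := bG.
have rr0 : 0 <= r + r' by rewrite addr_ge0.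
have [|Y3 hY3] := @qpow_inv_small w (r + r') 8^-1 w0 rr0; first by rewrite invr_gt0.
exists (Num.max Y1 (Num.max Y2 Y3)) => z; rewrite !gt_max => /and3P[z1 z2 z3].
have -> : F z * G z =
    qpow (h + h') z * ((F z * qpow (- h) z) * (G z * qpow (- h') z)).
  by rewrite qpowD !qpowN; field; rewrite !qpow_neq0.
apply: power_series_fourier.
apply: (@has_sum_mul _ (@complex_archi R) _ _ M%:C M'%:C (r + r')%:C).
- by rewrite lecR.
- by rewrite lecR.
- move=> n; apply: le_trans (aM n) _; rewrite ler_wpM2l ?lecR //.
  by apply: lerXn2r; rewrite ?nnegrE lecR // lerDl.
- move=> n; apply: le_trans (bM n) _; rewrite ler_wpM2l ?lecR //.
  by apply: lerXn2r; rewrite ?nnegrE lecR // lerDr.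
- by rewrite real_inv_nat; exact/ltW/hY3.
- exact/fourier_power_series/FY.
- exact/fourier_power_series/GY.
Qed.

(** The Lipschitz bound compares the series at [q^(1/w)], which tends to 0, with its value [a_0] at
    0. *)
Lemma leading_asymptotic w h a F (e : R) : (0 < w)%N -> 0 < e ->
  fourier_expansion w h a F ->
  exists Y : R, forall z, Y < complex.Im z ->
    `|F z * qpow (- h) z - a 0%N| < e%:C.
Proof.
move=> w0 e0 aF.
have [M [r [M0 r0 aM]]] := fourier_coef_growth aF.
have [Y1 FY] := aF.
have [|Y2 hY2] := @qpow_inv_small w r 4^-1 w0 r0; first by rewrite invr_gt0.
have [||Y3 hY3] := @qpow_inv_small w (8 * M * r) e w0 => //.
  by rewrite !mulr_ge0.
exists (Num.max Y1 (Num.max Y2 Y3)) => z; rewrite !gt_max => /and3P[z1 z2 z3].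
apply: le_lt_trans (hY3 z z3).
have -> : (8 * M * r)%:C = 8 * M%:C * r%:C by rewrite !rmorphM /= rmorph_nat.
rewrite [X in _ <= X]mulrC -[X in _ * `|X|]subr0.
apply: (@power_series_lipschitz _ a M%:C r%:C (qpow w%:R^-1 z) 0) => //.
- by rewrite lecR.
- by rewrite lecR.
- by rewrite real_inv_nat; exact/ltW/hY2.
- by rewrite normr0 mul0r invr_ge0.
- exact/fourier_power_series/FY.
- exact: has_sum_at0.
Qed.

(** [F q^-h] is locally Lipschitz in the continuous function [q^(1/w)]. As a result, taking the
    normal form leaves [F] unchanged for large [Im z]. *)
Lemma fourier_continuous w h a F : (0 < w)%N -> fourier_expansion w h a F ->
  exists Y : R, forall z : C, Y < complex.Im z -> {for z, continuous (F : C -> C)}.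
Proof.
move=> w0 aF.
have [M [r [M0 r0 aM]]] := fourier_coef_growth aF.
have [Y1 FY] := aF.
have [|Y2 hY2] := @qpow_inv_small w r 4^-1 w0 r0; first by rewrite invr_gt0.
exists (Num.max Y1 Y2) => z; rewrite gt_max => /andP[z1 z2].
pose x : C -> C := qpow w%:R^-1; pose G : C -> C := fun y => F y * qpow (- h) y.
have cG : {for z, continuous G}.
  apply/(@cvgrPdist_lt C C C (nbhs z) _) => e e0.
  have c0 : 0 < 8 * M%:C * r%:C + 1 :> R[i] by rewrite ltr_wpDl // !mulr_ge0 ?lecR.
  have : \forall y \near z, `|x z - x y| < e / (8 * M%:C * r%:C + 1).
    apply: (@cvgr_dist_lt C C C (nbhs z) _ x (x z)); first exact: continuous_qpow.
    by rewrite divr_gt0.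
  have := near_Im_gt z1; have := near_Im_gt z2.
  apply: (@filterS3 _ (nbhs z)) => y y2 y1; rewrite ltr_pdivlMr // => xzy.
  apply: le_lt_trans xzy; rewrite mulrC.
  apply: (@le_trans _ _ (8 * M%:C * r%:C * `|x z - x y|)).
    apply: (@power_series_lipschitz _ a M%:C r%:C (x z) (x y)) => //.
    + by rewrite lecR.
    + by rewrite lecR.
    + by rewrite real_inv_nat; exact/ltW/hY2.
    + by rewrite real_inv_nat; exact/ltW/hY2.
    + exact/fourier_power_series/FY.
    + exact/fourier_power_series/FY.
  by rewrite ler_wpM2r // lerDl.
have -> : F = G \* (qpow h : C -> C).
  by apply/funext => y; rewrite /G /= -mulrA -qpowD addNr qpow0 mulr1.
exact: (@continuousM C C G (qpow h : C -> C) z cG (@continuous_qpow R h z)).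
Qed.

(* If h < h', then F q^-h = (F q^-h') q^(h'-h) tends to 0, not to a_0. *)
Lemma leading_coef_exponent_le w w' h h' a b F : (0 < w)%N -> (0 < w')%N ->
  fourier_expansion w h a F -> fourier_expansion w' h' b F -> a 0%N != 0 -> h' <= h.
Proof.
move=> w0 w'0 aF bF a0; rewrite leNgt; apply/negP => hh'.
have n1 : `|a 0%N| = (complex.Re `|a 0%N|)%:C by rewrite RRe_real ?normr_real.
have n0 : 0 < complex.Re `|a 0%N| by rewrite -ltcR -n1 normr_gt0.
set c := complex.Re _ in n1 n0.
have m1 : `|b 0%N| = (complex.Re `|b 0%N|)%:C by rewrite RRe_real ?normr_real.
have m0 : 0 <= complex.Re `|b 0%N| by rewrite -ler0c -m1 normr_ge0.
set d := complex.Re _ in m1 m0.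
have c2 : 0 < c / 2 by rewrite divr_gt0.
have [Y1 h1] := leading_asymptotic w0 c2 aF.
have [Y2 h2] := leading_asymptotic w'0 ltr01 bF.
have d1 : 0 < d + 1 by rewrite ltr_wpDl.
(* As [|F q^-h'| <= d + 1], this choice makes [|F q^-h| <= c/2]; being also within [c/2] of [a_0],
   it contradicts [|a_0| = c]. *)
have [||Y3 h3] := @qpow_small R (h' - h) (c / 2 / (d + 1)).
- by rewrite subr_gt0.
- by rewrite divr_gt0.
pose Y := Num.max Y1 (Num.max Y2 Y3) + 1.
have : Num.max Y1 (Num.max Y2 Y3) < complex.Im (Complex 0 Y) by rewrite /= ltrDl.
move: (Complex 0 Y) => z; rewrite !gt_max => /and3P[/h1 z1 /h2 z2 /h3 z3].
have FE : F z * qpow (- h) z = F z * qpow (- h') z * qpow (h' - h) z.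
  by rewrite -mulrA -qpowD addrA addNr add0r.
have F2 : `|F z * qpow (- h') z| <= (d + 1)%:C.
  rewrite -(subrK (b 0%N) (F z * qpow (- h') z)); apply: le_trans (ler_normD _ _) _.
  by rewrite m1 addrC rmorphD lerD2l ltW.
have F1 : `|F z * qpow (- h) z| <= (c / 2)%:C.
  rewrite FE normrM; apply: (@le_trans _ _ ((d + 1)%:C * (c / 2 / (d + 1))%:C)).
    by apply: ler_pM => //; exact: ltW.
  by rewrite -rmorphM lecR mulrC divfK // gt_eqF.
have : `|a 0%N| < (c / 2)%:C + (c / 2)%:C.
  rewrite -(subrK (F z * qpow (- h) z) (a 0%N)); apply: le_lt_trans (ler_normD _ _) _.
  by rewrite distrC ltr_leD.
by rewrite -rmorphD -splitr n1 ltxx.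
Qed.

(** Nonvanishing of both coefficients forces the exponents to agree, even for different widths; then
    both are limits of the same [F q^-h]. *)
Lemma is_leading_coef_uniq F (c d : R[i]) :
  is_leading_coef F c -> is_leading_coef F d -> c = d.
Proof.
move=> [w [h [a [w0 aF a0 c0]]]] [w' [h' [b [w'0 bF b0 d0]]]].
have hh' : h = h'.
  apply/eqP; rewrite eq_le.
  rewrite (leading_coef_exponent_le w'0 w0 bF aF) ?b0 //.
  by rewrite (leading_coef_exponent_le w0 w'0 aF bF) ?a0.
rewrite -a0 -b0; apply/eqP; rewrite -subr_eq0 -normr_le0.
have E : `|a 0%N - b 0%N| = (complex.Re `|a 0%N - b 0%N|)%:C.
  by rewrite RRe_real ?normr_real.
set e := complex.Re _ in E; rewrite E lecR leNgt; apply/negP => e0.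
have e2 : 0 < e / 2 by rewrite divr_gt0.
have [Y1 h1] := leading_asymptotic w0 e2 aF.
have [Y2 h2] := leading_asymptotic w'0 e2 bF.
pose Y := Num.max Y1 Y2 + 1.
have : Num.max Y1 Y2 < complex.Im (Complex 0 Y) by rewrite /= ltrDl.
move: (Complex 0 Y) => z; rewrite !gt_max => /andP[/h1 z1 /h2 z2].
have : `|a 0%N - b 0%N| < (e / 2)%:C + (e / 2)%:C.
  rewrite -(subrKA (F z * qpow (- h) z)); apply: le_lt_trans (ler_normD _ _) _.
  by apply: ltrD; [rewrite distrC | rewrite hh'].
by rewrite -rmorphD -splitr E ltxx.
Qed.

Lemma leading_coefE F (c : R[i]) : is_leading_coef F c -> leading_coef F = c.
Proof.
by move=> Fc; apply: xget_unique => // d Fd; exact: is_leading_coef_uniq Fd Fc.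
Qed.

Lemma is_leading_coefZ F G (c d : R[i]) : d != 0 ->
  (forall z, upper_half_plane z -> G z = d * F z) ->
  is_leading_coef F c -> is_leading_coef G (d * c).
Proof.
move=> d0 GF [w [h [a [w0 [Y aF] a0 c0]]]].
exists w, h, (fun n => d * a n); split=> //; last 2 first.
- by rewrite a0.
- by rewrite mulf_neq0.
(* The maximum with 0 keeps [z] in the upper half-plane, where [G = d F]. *)
exists (Num.max Y 0) => z; rewrite gt_max => /andP[zY z0]; rewrite GF //.
have := @has_sumZ R[i] d _ _ (aF z zY).
suff -> : (fun n => d * (a n * qpow (h + n%:R / w%:R) z)) =
  (fun n => d * a n * qpow (h + n%:R / w%:R) z) by [].
by apply/funext => n; rewrite mulrA.
Qed.

(** As [d] is invertible, [F] and [G] have leading coefficients simultaneously; if neither has one,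
    both sides are the default 0. *)
Lemma leading_coefZ F G (d : R[i]) : d != 0 ->
  (forall z, upper_half_plane z -> G z = d * F z) ->
  leading_coef G = d * leading_coef F.
Proof.
move=> d0 GF; have [[c Fc]|nF] := pselect (exists c, is_leading_coef F c).
  by rewrite (leading_coefE Fc); apply: leading_coefE; exact: is_leading_coefZ Fc.
have none (E : R[i] -> R[i]) : (forall c, ~ is_leading_coef E c) -> leading_coef E = 0.
  by move=> nE; apply: xgetPN => c; exact: nE.
rewrite (none F) => [|c Fc]; last by apply: nF; exists c.
rewrite mulr0; apply: none => c Gc; apply: nF; exists (d^-1 * c).
apply: is_leading_coefZ Gc; first by rewrite invr_eq0.
by move=> z /GF ->; rewrite mulKf.
Qed.

End FourierExpansion.

(** * Hecke operators *)

Section HeckeOperators.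
Variable R : realType.
Local Notation C := (R[i] : numFieldType).
Local Notation "x %:C" := (real_complex R x) : ring_scope.
Implicit Types (f F : R[i] -> R[i]) (z : R[i]) (n m p l : nat) (k : int) (h : R).

(** The product defining [f | T(n)], stripped of its weight-dependent constants, so that iteration
    becomes a reindexing. *)
Definition translate_product n f z : R[i] :=
  \prod_(m < n) f (n%:R^-1 * (z + m%:R)).

Lemma det_mat2 n m : \det (mat2 1 m%:Z 0 n%:Z) = n%:Z.
Proof.
rewrite -det_tr det_trig; last first.
  apply/is_trig_mxP => -[[|[|i]] hi] [[|[|j]] hj] //= _.
  by rewrite !mxE.
by rewrite !big_ord_recl big_ord0 !mxE /= mul1r mulr1.
Qed.

(** The lower row is [(0, n)], so the automorphy factor is constant and the weight enters only
    through a scalar. *)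
Lemma slash_mat2 k f n m z :
  slash k f (mat2 1 m%:Z 0 n%:Z) z =
  (n%:R `^ (k%:~R / 2))%:C * n%:R ^ (- k) * f (n%:R^-1 * (z + m%:R)).
Proof.
rewrite /slash /moebius /automorphy det_mat2 !mxE /=.
rewrite mulr1z mulr0z -!pmulrn.
by rewrite (mul1r z) (mul0r z) add0r (mulrC (z + _)).
Qed.

Lemma hecke_productE n k f : (0 < n)%N ->
  exists2 c : R[i], c != 0 &
    forall z, hecke_product n k f z = c * normal_form (translate_product n f) z.
Proof.
move=> n0; have nR : 0 < n%:R :> R by rewrite ltr0n.
have powR_neq0 (x : R) : (n%:R `^ x)%:C != 0 :> R[i].
  by rewrite fmorph_eq0 gt_eqF // powR_gt0.
pose c : R[i] := (n%:R `^ ((k * n%:Z)%:~R / 2))%:C *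
  ((n%:R `^ (k%:~R / 2))%:C * n%:R ^ (- k)) ^+ n.
have c0 : c != 0.
  rewrite mulf_neq0 // expf_neq0 // mulf_neq0 //.
  by rewrite expfz_neq0 // pnatr_eq0 -lt0n.
exists c => // z; rewrite /hecke_product -normal_form_scale //.
congr (normal_form _ z); apply/funext => y.
under eq_bigr do rewrite slash_mat2.
by rewrite big_split /= prodr_const card_ord mulrA.
Qed.

Lemma Im_translate n m z : complex.Im (n%:R^-1 * (z + m%:R)) = n%:R^-1 * complex.Im z.
Proof.
case: z => x y; rewrite real_inv_nat -[m%:R](rmorph_nat (real_complex R)) /=.
by rewrite addr0 mul0r addr0.
Qed.

Lemma upper_half_plane_translate n m z : (0 < n)%N ->
  upper_half_plane z -> upper_half_plane (n%:R^-1 * (z + m%:R)).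
Proof.
move=> n0; rewrite /upper_half_plane /= Im_translate => z0.
by rewrite mulr_gt0 // invr_gt0 ltr0n.
Qed.

(** Substituting [(z + m)/n] turns [q^(h+i)] into [q^((h+i)/n)] times a nonzero constant. All
    translates thus share the width [n], as multiplying them requires. *)
Lemma fourier_expansion_translate h (a : nat -> R[i]) f n m : (0 < n)%N ->
  fourier_expansion 1 h a f ->
  fourier_expansion n (h / n%:R)
    (fun i => a i * qpow (h + i%:R) (n%:R^-1 * m%:R))
    (fun z => f (n%:R^-1 * (z + m%:R))).
Proof.
move=> n0 [Y fY]; have nR : 0 < n%:R :> R by rewrite ltr0n.
exists (n%:R * Y) => z zY.
have : Y < complex.Im (n%:R^-1 * (z + m%:R)).
  by rewrite Im_translate mulrC ltr_pdivlMr // mulrC.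
move=> /fY.
suff -> : (fun i => a i * qpow (h + i%:R / 1%:R) (n%:R^-1 * (z + m%:R))) =
  (fun i => a i * qpow (h + i%:R) (n%:R^-1 * m%:R) *
    qpow (h / n%:R + i%:R / n%:R) z) by [].
apply/funext => i; rewrite divr1 mulrDr qpowDr.
rewrite [_ * z](_ : _ = (n%:R^-1)%:C * z); last first.
  by rewrite -real_inv_nat.
by rewrite qpow_scale mulrDl -mulrA; congr (_ * _); rewrite mulrC.
Qed.

(** By induction from the constant 1: a Cauchy product starts with [a_0 b_0], which stays
    nonzero. *)
Lemma fourier_expansion_prod w (n : nat) (F : 'I_n -> R[i] -> R[i]) : (0 < w)%N ->
  (forall i, exists h (a : nat -> R[i]), a 0%N != 0 /\
    fourier_expansion w h a (F i)) ->
  exists h (a : nat -> R[i]), a 0%N != 0 /\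
    fourier_expansion w h a (fun z => \prod_(i < n) F i z).
Proof.
move=> w0; elim: n F => [|n ih] F hF.
  exists 0, (fun i => (i == 0%N)%:R); split; first exact: oner_neq0.
  exists 0 => z _; rewrite big_ord0.
  have := @power_series_fourier R 0 w (fun i => (i == 0%N)%:R) 1 z.
  rewrite qpow0 mul1r; apply.
  apply: cvg_near_cst; exists 1%N => // -[//|i] _.
  rewrite /series /= big_nat_recl //= expr0 mulr1 big1 ?addr0 //.
  by move=> j _; rewrite mul0r.
have [h [a [a0 aF]]] := hF ord0.
have [h' [b [b0 bF]]] := ih (fun i => F (lift ord0 i)) (fun i => hF _).
exists (h + h'), (cauchy_product a b); split.
  by rewrite /cauchy_product big_ord1 /= mulf_neq0.
have -> : (fun z => \prod_(i < n.+1) F i z) =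
    (fun z => F ord0 z * \prod_(i < n) F (lift ord0 i) z).
  by apply/funext => z; rewrite big_ord_recl.
exact: fourier_expansion_mul.
Qed.

Lemma leading_coef_normal_form w h (a : nat -> R[i]) F : (0 < w)%N -> a 0%N != 0 ->
  fourier_expansion w h a F -> is_leading_coef (normal_form F) (a 0%N).
Proof.
move=> w0 a0 aF; exists w, h, a; split; [exact: w0 | | reflexivity | exact: a0].
have [Y1 FY] := aF; have [Y2 cF] := fourier_continuous w0 aF.
exists (Num.max Y1 Y2) => z; rewrite gt_max => /andP[z1 z2].
by rewrite (normal_form_continuous (cF z z2)); exact: FY.
Qed.

(* Without this, the junk value [0^-1 = 0] could make [f | T(n)] vanish. *)
Lemma leading_coef_hecke_product_neq0 n k h (a : nat -> R[i]) f : (0 < n)%N ->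
  a 0%N != 0 -> fourier_expansion 1 h a f -> leading_coef (hecke_product n k f) != 0.
Proof.
move=> n0 a0 af.
have [h' [b [b0 bF]]] : exists h (b : nat -> R[i]), b 0%N != 0 /\
    fourier_expansion n h b (translate_product n f).
  apply: (fourier_expansion_prod n0) => i.
  exists (h / n%:R), (fun m => a m * qpow (h + m%:R) (n%:R^-1 * (i : nat)%:R)).
  split; last exact: fourier_expansion_translate.
  by rewrite mulf_neq0 // qpow_neq0.
have [c c0 cE] := hecke_productE k f n0.
rewrite (leading_coefZ c0 (fun z _ => cE z)).
by rewrite (leading_coefE (leading_coef_normal_form n0 b0 bF)) mulf_neq0.
Qed.

(** Each [(z + i)/n] lies in the upper half-plane, where [f] is meromorphic. *)
Lemma translate_product_continuous_near_punctured n f z : (0 < n)%N ->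
  meromorphic_on_H f -> upper_half_plane z ->
  continuous_near_punctured (translate_product n f) z.
Proof.
move=> n0 mf zH; apply: continuous_near_punctured_prod => i.
apply: continuous_near_punctured_affine; first by rewrite invr_eq0 pnatr_eq0 -lt0n.
by apply: meromorphic_at_continuous;
  have [] := mf _ (upper_half_plane_translate i n0 zH).
Qed.

(* The residues modulo nm are the numbers i + m j with i < m and j < n. *)
Lemma translate_product_comp n m f z : (0 < n)%N -> (0 < m)%N ->
  translate_product m (translate_product n f) z = translate_product (n * m) f z.
Proof.
move=> n0 m0; rewrite /translate_product exchange_big /=.
(* The range of length [n m] is cut into [n] consecutive blocks of length [m], block [j] starting at
   [j m]. *)
rewrite -(big_mkord xpredT (fun j => f ((n * m)%:R^-1 * (z + j%:R)))) big_nat_mul.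
rewrite big_mkord; apply: eq_bigr => j _.
rewrite -[(j * m)%N]add0n big_addn mulSn addnK big_mkord.
apply: eq_bigr => i _; congr f; rewrite natrM natrD natrM.
by field; rewrite !pnatr_eq0 -!lt0n n0 m0.
Qed.

(** The inner normal form is harmless: for [y] near but not at [z], none of the finitely many
    arguments [(y + i)/m] meets a point where it changes the product, and the outer normal form
    ignores the value at [z]. *)
Lemma normal_form_translate_product n m f z : (0 < n)%N -> (0 < m)%N ->
  meromorphic_on_H f -> upper_half_plane z ->
  normal_form (translate_product m (normal_form (translate_product n f))) z =
  normal_form (translate_product (n * m) f) z.
Proof.
move=> n0 m0 mf zH; apply: normal_form_near.
have : \forall y \near (z : C)^', forall i : 'I_m,
    normal_form (translate_product n f) (m%:R^-1 * (y + i%:R)) =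
    translate_product n f (m%:R^-1 * (y + i%:R)).
  apply: filter_forall => i.
  have m1 : (m%:R^-1 : C) != 0 by rewrite invr_eq0 pnatr_eq0 -lt0n.
  have cf := translate_product_continuous_near_punctured n0 mf
    (upper_half_plane_translate i m0 zH).
  exact: (shift_scale_punctured m1 (near_punctured_normal_form cf)).
apply: (@filterS _ (nbhs (z : C)^')) => y yE; rewrite -translate_product_comp //.
by apply: eq_bigr => i _; exact: yE.
Qed.

(** The scalars of both steps collect into one nonzero factor, [c' * d ^+ m], which division by the
    leading coefficient cancels. What remains is symmetric in [n] and [m]. *)
Lemma hecke_hecke N n m k k' f z : (0 < n)%N -> (0 < m)%N ->
  in_M N k f -> upper_half_plane z ->
  hecke m k' (hecke n k f) z =
  (leading_coef (normal_form (translate_product (n * m) f)))^-1 *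
    normal_form (translate_product (n * m) f) z.
Proof.
move=> n0 m0 [mf _ _ [h [a [a0 af]]]] zH.
have lc0 : leading_coef (hecke_product n k f) != 0.
  by apply: (leading_coef_hecke_product_neq0 k n0 _ af); rewrite a0 oner_neq0.
have [c c0 cE] := hecke_productE k f n0.
pose d := (leading_coef (hecke_product n k f))^-1 * c.
have d0 : d != 0 by rewrite mulf_neq0 // invr_eq0.
have hE y : hecke n k f y = d * normal_form (translate_product n f) y.
  by rewrite /hecke cE mulrA.
have [c' c'0 c'E] := hecke_productE k' (hecke n k f) m0.
have e0 : c' * d ^+ m != 0 by rewrite mulf_neq0 // expf_neq0.
(* Each of the [m] translates contributes one factor [d]. *)
have TE : translate_product m (hecke n k f) =
    (fun y => d ^+ m * translate_product m (normal_form (translate_product n f)) y).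
  apply/funext => y; rewrite /translate_product.
  by under eq_bigr do rewrite hE; rewrite big_split /= prodr_const card_ord.
have PE y : upper_half_plane y -> hecke_product m k' (hecke n k f) y =
    c' * d ^+ m * normal_form (translate_product (n * m) f) y.
  move=> yH; rewrite c'E TE normal_form_scale ?expf_neq0 //.
  by rewrite normal_form_translate_product // mulrA.
rewrite {1}/hecke (leading_coefZ e0 PE) PE // invfM.
by rewrite mulrACA mulVf // mul1r.
Qed.

End HeckeOperators.

Theorem theorem3p7 (R : realType) (N p l : nat)
  (hN : (1 <= N)%N) (hp : prime p) (hl : prime l) (hpl : p <> l)
  (hpN : (p %| N)%N) (hlN : (l %| N)%N)
  (k : int) (f : R[i] -> R[i]) (hf : in_M N k f)
  (tau : R[i]) (htau : upper_half_plane tau) :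
  hecke l (k * p%:Z) (hecke p k f) tau = hecke p (k * l%:Z) (hecke l k f) tau.
Proof.
have [p0 l0] := (prime_gt0 hp, prime_gt0 hl).
by rewrite (hecke_hecke _ p0 l0 hf htau) (hecke_hecke _ l0 p0 hf htau) mulnC.
Qed.
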